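(* Let $(G,X,x_0)$ be a $0$-dimensional ambit and $\mathcal{B}$ the Boolean algebra of clopen subsets of $X$. Assume that there is a cofinal, upward directed by inclusion family $\mathcal{D}=\{\Delta_i\}_{i\in I}$ of subsets of $\mathcal{B}$ such that for every $\Delta\in\mathcal{D}$ the $G$-ambit $X$ has joint. fin. EDRdeg with respect to $\Delta$. Then there exists $\eta\in E(X)$ such that for every $i\in I$ the subspace $(G\eta)|^*_{\Delta_i}:=\{(g\eta)|^*_{\Delta_i}: g\in G\}$ of $E(X)|^*_{\Delta_i}$ is finite and $\Phi[E(X)\eta]=\varprojlim_i (G\eta)|^*_{\Delta_i}$, where $\Phi\colon E(X)\to\varprojlim_i E(X)|^*_{\Delta_i}$ is the homeomorphism given by $\Phi(\xi)=(\xi|^*_{\Delta_i})_{i\in I}$.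
   Context: Compact spaces are Hausdorff. A flow $(G,X)$ is a topological group $G$ acting continuously on a compact space $X$. An ambit $(G,X,x_0)$ is a flow with a distinguished point $x_0\in X$ whose orbit is dense; it is $0$-dimensional if $X$ has a basis of clopen sets. The Ellis semigroup $E(X)$ is the closure in $X^X$ (product topology) of the set of maps $x\mapsto gx$, $g\in G$, with composition; $G$ acts on it by $(g\eta)(x)=g(\eta(x))$, and $E(X)\eta=\{\xi\eta:\xi\in E(X)\}$. A coloring is a function $c\colon G\to 2^n$, $n\ge 1$. For $\Sigma\subseteq\mathcal{B}$ (possibly infinite), $c$ is an externally definable $\Sigma$-coloring if there are $U_0,\dots,U_{n-1}\in\Sigma$ and $y_0,\dots,y_{n-1}\in X$ such that for all $g\in G$, $i<n$: $c(g)(i)=1$ if $y_i\in gU_i$ and $c(g)(i)=0$ if $y_i\notin gU_i$. The ambit has joint. fin. EDRdeg with respect to $\Sigma$ if there is $l\ge 1$ such that for every externally definable $\Sigma$-coloring $c\colon G\to 2^n$ (any $n\geq 1$), every $k\ge 1$ and every $k$-element $A\subseteq G$, there is $h\in G$ with $|c[hA]|\le l$. For $\Delta\subseteq\mathcal{B}$ let $\mathcal{A}(\Delta)$ be the Boolean algebra (not necessarily $G$-invariant) of subsets of $X$ generated by $\Delta$, and $S(\mathcal{A}(\Delta))$ its Stone space. For $\eta\in E(X)$ define $\eta|^*_\Delta\colon X\to S(\mathcal{A}(\Delta))$ by $\eta|^*_\Delta(x)=\{U\in\mathcal{A}(\Delta): \eta(x)\in U\}$, and put $E(X)|^*_\Delta=\{\eta|^*_\Delta:\eta\in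 E(X)\}$ with the topology induced from the product topology on $S(\mathcal{A}(\Delta))^X$. For $\Delta_0\subseteq\Delta_1$ the connecting map $E(X)|^*_{\Delta_1}\to E(X)|^*_{\Delta_0}$ sends $\eta|^*_{\Delta_1}$ to $\eta|^*_{\Delta_0}$. A family $\mathcal{D}$ of subsets of $\mathcal{B}$ is cofinal if each $U\in\mathcal{B}$ belongs to some $\Delta\in\mathcal{D}$; an upward directed family is indexed as $\{\Delta_i\}_{i\in I}$ by a directed set $(I,\le)$ with $i\le i'$ iff $\Delta_i\subseteq\Delta_{i'}$, and the inverse limits are over $I$ with the connecting maps $E(X)|^*_{\Delta_{i'}}\to E(X)|^*_{\Delta_i}$, $\xi|^*_{\Delta_{i'}}\mapsto\xi|^*_{\Delta_i}$, for $i\le i'$ (restricted to the sets $(G\eta)|^*_{\Delta_{i'}}\to(G\eta)|^*_{\Delta_i}$ in the case of $\varprojlim_i(G\eta)|^*_{\Delta_i}$). *)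

(* Defs.v *)
From HB Require Import structures.
From mathcomp Require Import all_boot.
From mathcomp Require Import all_classical all_reals all_analysis.

Set Implicit Arguments.
Unset Strict Implicit.
Unset Printing Implicit Defensive.

Local Open Scope classical_set_scope.

(* No separation axiom is imposed on a topological group. *)
HB.mixin Record isTopologicalGroup G & Topological G & Group G := {
  mulg_continuous : continuous (fun p : G * G => (p.1 * p.2)%g) ;
  invg_continuous : continuous (fun g : G => (g^-1)%g) ;
}.

#[short(type="topologicalGroupType")]
HB.structure Definition TopologicalGroup :=
  {G of Topological G & Group G & isTopologicalGroup G}.

Section Flows.
Context {G : topologicalGroupType} {X : topologicalType} (act : G -> X -> X).

Definition flow : Prop :=
  [/\ compact [set: X], hausdorff_space X,
      (forall x, act 1%g x = x),
      (forall g h x, act (g * h)%g x = act g (act h x)) &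
      continuous (fun p : G * X => act p.1 p.2)].

Definition ambit (x0 : X) : Prop := flow /\ dense (range (act^~ x0)).

(* [zero_dimensional] of the library asks that clopen sets separate points;
   here the clopen sets form a basis. *)
Definition zero_dimensional_ambit (x0 : X) : Prop :=
  ambit x0 /\ basis (@clopen X).

Definition ellis : set {ptws X -> X} :=
  closure (range (act : G -> {ptws X -> X})).

(* E(X) eta *)
Definition ellis_mul (eta : {ptws X -> X}) : set {ptws X -> X} :=
  [set (xi \o eta : {ptws X -> X}) | xi in ellis].

(* G eta *)
Definition orbit_mul (eta : {ptws X -> X}) : set {ptws X -> X} :=
  range (fun g : G => (act g \o eta : {ptws X -> X})).

(* Elements of 2^n are finite functions, so that they have Leibniz equality. *)
Definition ext_definable_coloring (Sigma : set (set X)) (n : nat)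
    (c : G -> {ffun 'I_n -> bool}) : Prop :=
  exists (U : 'I_n -> set X) (y : 'I_n -> X),
    (forall i, Sigma (U i)) /\
    forall g i, c g i = `[< (act g @` U i) (y i) >].

Definition joint_fin_EDRdeg (Sigma : set (set X)) : Prop :=
  exists2 l : nat, (1 <= l)%N &
    forall (n : nat) (c : G -> {ffun 'I_n -> bool}), (1 <= n)%N ->
      ext_definable_coloring Sigma c ->
      forall (k : nat) (A : set G), (1 <= k)%N -> (A #= `I_k)%card ->
        exists h : G, ([set c (h * a)%g | a in A] #<= `I_l)%card.

End Flows.

Section Stone.
Context {X : Type}.

Definition set_algebra (F : set (set X)) : Prop :=
  [/\ F setT, setU_closed F & setC_closed F].

Definition gen_algebra (Delta : set (set X)) : set (set X) :=
  smallest set_algebra Delta.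

Lemma gen_algebraP (Delta : set (set X)) : set_algebra (gen_algebra Delta).
Proof.
split; first by move=> F [[]].
- by move=> A B FA FB F FD; have [[_ FU _] _] := FD; exact: FU (FA _ FD) (FB _ FD).
- by move=> A FA F FD; have [[_ _ FC] _] := FD; exact: FC (FA _ FD).
Qed.

Lemma gen_algebraS (D0 D1 : set (set X)) :
  D0 `<=` D1 -> gen_algebra D0 `<=` gen_algebra D1.
Proof. exact: sub_smallest2r (gen_algebraP D1). Qed.

Lemma gen_algebraI (Delta : set (set X)) (A B : set X) :
  gen_algebra Delta A -> gen_algebra Delta B -> gen_algebra Delta (A `&` B).
Proof.
have [_ DU DC] := gen_algebraP Delta.
move=> DA DB; rewrite -[_ `&` _]setCK setCI; apply: (DC).
by apply: DU; exact: DC.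
Qed.

Definition algebra_ultrafilter (F p : set (set X)) : Prop :=
  [/\ p `<=` F, p setT /\ ~ p set0,
      (forall A B, p A -> p B -> p (A `&` B)),
      (forall A B, F B -> A `<=` B -> p A -> p B) &
      (forall A, F A -> p A \/ p (~` A))].

(* The Stone space of the algebra of sets generated by Delta. *)
Record stone (Delta : set (set X)) : Type := Stone {
  stone_sets : set (set X) ;
  stoneP : algebra_ultrafilter (gen_algebra Delta) stone_sets }.

Lemma stone_inj (Delta : set (set X)) : injective (@stone_sets Delta).
Proof. by move=> [p pP] [q qP] /= e; subst q; congr Stone; exact: Prop_irrelevance. Qed.

HB.instance Definition _ (Delta : set (set X)) := gen_eqMixin (stone Delta).
HB.instance Definition _ (Delta : set (set X)) := gen_choiceMixin (stone Delta).

Section StoneTopology.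
Context (Delta : set (set X)).

Let clopen_base (U : set X) : set (stone Delta) := [set p | stone_sets p U].

Let clopen_base_cover :
  \bigcup_(U in gen_algebra Delta) clopen_base U = setT.
Proof.
apply/seteqP; split=> // p _; exists setT; first by case: (gen_algebraP Delta).
by case: p => p [] /= _ [].
Qed.

Let clopen_base_join (U V : set X) (p : stone Delta) :
  gen_algebra Delta U -> gen_algebra Delta V ->
  clopen_base U p -> clopen_base V p ->
  exists W, [/\ gen_algebra Delta W, clopen_base W p &
                clopen_base W `<=` clopen_base U `&` clopen_base V].
Proof.
move=> DU DV pU pV; exists (U `&` V); split.
- by case: (stoneP p) => sp _ pI _ _; apply: sp; exact: pI.
- by case: (stoneP p) => _ _ pI _ _; exact: pI.
- move=> q qUV; have [_ _ _ qS _] := stoneP q.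
  by split; [apply: qS qUV => //; exact: subIsetl|apply: qS qUV => //; exact: subIsetr].
Qed.

HB.instance Definition _ :=
  isBaseTopological.Build (stone Delta) clopen_base_cover clopen_base_join.

End StoneTopology.

Lemma stone_pointP (Delta : set (set X)) (x : X) :
  algebra_ultrafilter (gen_algebra Delta) [set U | gen_algebra Delta U /\ U x].
Proof.
have [DT _ DC] := gen_algebraP Delta; split=> /=.
- by move=> U [].
- by split=> // -[].
- by move=> A B [DA Ax] [DB Bx]; split=> //; exact: gen_algebraI.
- by move=> A B DB AB [_ /AB].
- move=> A DA; have [Ax|Ax] := pselect (A x); [by left|right].
  by split=> //; exact: DC.
Qed.

Definition stone_point (Delta : set (set X)) (x : X) : stone Delta :=
  Stone (stone_pointP Delta x).

End Stone.

(* eta|^*_Delta *)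
Definition restr {X : topologicalType} (Delta : set (set X))
    (eta : {ptws X -> X}) : {ptws X -> stone Delta} :=
  fun x => stone_point Delta (eta x).

Section Connecting.
Context {G : topologicalGroupType} {X : topologicalType} (act : G -> X -> X).

(* Defined on E(X)|^*_D1 by picking any eta in E(X) with eta|^*_D1 = f, and by a
   junk value elsewhere; by [conn_restr] the choice of eta is irrelevant. *)
Definition conn (D1 D0 : set (set X)) (f : {ptws X -> stone D1}) :
    {ptws X -> stone D0} :=
  restr D0 (xget (id : {ptws X -> X})
    [set eta | ellis act eta /\ restr D1 eta = f]).

Lemma conn_restr (D0 D1 : set (set X)) (eta : {ptws X -> X}) :
  D0 `<=` D1 -> ellis act eta -> conn D0 (restr D1 eta) = restr D0 eta.
Proof.
move=> D01 Eeta; rewrite /conn; case: xgetP => [xi _ [_ xiE]|/(_ eta)]; last first.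
  by case.
apply/funext => x; apply: stone_inj; apply/funext => U.
have e := congr1 (fun f => stone_sets (f x) U) xiE.
have {}e : (gen_algebra D1 U /\ U (xi x)) = (gen_algebra D1 U /\ U (eta x)) := e.
apply/propext; split=> -[DU Ux]; split=> //; have D1U := gen_algebraS D01 DU.
- by have [_] : gen_algebra D1 U /\ U (eta x) by rewrite -e.
- by have [_] : gen_algebra D1 U /\ U (xi x) by rewrite e.
Qed.

End Connecting.

Definition directed_set (I : Type) (le : I -> I -> Prop) : Prop :=
  [/\ inhabited I, (forall i, le i i),
      (forall i j k, le i j -> le j k -> le i k) &
      (forall i j, exists k, le i k /\ le j k)].

Definition cofinal_family (X : topologicalType) (D : set (set (set X))) : Prop :=
  forall U, clopen U -> exists2 Delta, D Delta & Delta U.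

(* The inverse limit of the sets S i, with maps tr i j from level j to level i
   for i <= j, as a subset of the product. *)
Definition inverse_limit (I : Type) (le : I -> I -> Prop)
    (T : I -> topologicalType) (S : forall i, set (T i))
    (tr : forall i j, T j -> T i) : set (prod_topology T) :=
  [set f | (forall i, S i (f i)) /\ forall i j, le i j -> tr i j (f j) = f i].

Definition homeomorphism_between (T U : topologicalType) (A : set T) (B : set U)
    (f : T -> U) : Prop :=
  [/\ set_bij A B f, {within A, continuous f} &
      exists2 g : U -> T, {in A, cancel f g} & {within B, continuous g}].

Section Limits.
Context {G : topologicalGroupType} {X : topologicalType} (act : G -> X -> X).
Context {I : Type} (le : I -> I -> Prop) (Delta : I -> set (set X)).

Definition Phi (xi : {ptws X -> X}) :
    prod_topology (fun i => {ptws X -> stone (Delta i)}) :=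
  fun i => restr (Delta i) xi.

(* The inverse limit of the sets S|^*_(Delta i), for S a subset of E(X). *)
Definition restr_limit (S : set {ptws X -> X}) :
    set (prod_topology (fun i => {ptws X -> stone (Delta i)})) :=
  inverse_limit le (fun i => restr (Delta i) @` S)
    (fun i j => @conn G X act (Delta j) (Delta i)).

End Limits.

Arguments Phi {X I} Delta xi.
Arguments restr_limit {G X} act {I} le Delta S.

(* Main.v *)
Require Import Defs.
From HB Require Import structures.
From mathcomp Require Import all_boot.
From mathcomp Require Import all_classical all_reals all_analysis.

Set Implicit Arguments.
Unset Strict Implicit.
Unset Printing Implicit Defensive.

Local Open Scope classical_set_scope.

(** The idea is to find one [eta] that lies in every closed two-sided ideal of
the Ellis semigroup E(X), and to recognise finiteness of [(G eta)|^*_Delta] as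
membership in such an ideal.

Call the elements [g eta] of the orbit, restricted to [Delta], the types of
[eta] over [Delta]. For a bound [l], the set [few_types l] of the [eta] in E(X)
with at most [l] types over [Delta] is stable under composition with E(X) on
both sides: on the right because [g (eta xi)] is determined by [g eta] at the
points [xi x], and on the left because translating by [h] only permutes the
orbit, and the bound passes to limits. Bounding the number of types only
involves finitely many clopen conditions at a time, so [few_types l] is closed;
and the degree hypothesis says precisely that each finite part of these
conditions is met by some translation [act h^-1]. Compactness of E(X) then makes
[few_types l] a nonempty closed two-sided ideal ([fin_EDRdeg_ideal]).

The bounds [l] depend on [Delta] and need not be monotone along the directed
family, so the sets [few_types l] for different [Delta] are not nested.
Two-sided ideals nevertheless meet, since a product of members of two of them
lies in both; by compactness a single [eta] lies in all closed two-sided ideals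
([closed_ideal_common]).

For the inverse limits, compactness shows that [Phi] maps any closed
subset [S] of E(X) onto the inverse limit of its restrictions: the elements of
[S] with prescribed restriction to [Delta i] form a directed family of nonempty
closed sets ([Phi_image]). With [S = E(X)] this is the surjectivity of [Phi].
With [S = E(X) eta] it is the description of [Phi[E(X) eta]], because
[(E(X) eta)|^*_Delta] is contained in the closure of the finite set
[(G eta)|^*_Delta] and hence equal to it ([restr_ellis_mul]). *)

(** * Compactness and product topologies *)

Lemma compact_directed_meet (T : topologicalType) (S : set T) (J : Type)
    (F : J -> set T) :
  compact S -> inhabited J ->
  (forall i j, exists k, F k `<=` F i `&` F j) ->
  (forall j, closed (F j)) -> (forall j, S `&` F j !=set0) ->
  S `&` \bigcap_j F j !=set0.
Proof.
move=> cS [j0] dirF clF SF0.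
pose B := filter_from [set: J] (fun j => S `&` F j).
have fB : ProperFilter B.
  apply: filter_from_proper; last by move=> j _; exact: SF0.
  apply: filter_from_filter; first by exists j0.
  move=> i j _ _; have [k kij] := dirF i j; exists k => // x [Sx /kij[]] //.
have [|x [Sx clx]] := cS B fB; first by exists j0 => // x [].
exists x; split=> // j _; apply: clF => V Vx.
have BFj : B (F j) by exists j => // y [].
exact: clx BFj Vx.
Qed.

Lemma cvg_prodP (I : Type) (T : I -> topologicalType)
    (F : set_system (prod_topology T)) (f : prod_topology T) : Filter F ->
  F --> f <-> forall i, (fun g : prod_topology T => g i) @ F --> f i.
Proof.
move=> fF; split=> [Ff i|Ff].
  exact: cvg_trans (cvg_app _ Ff) (@proj_continuous {classic I} T i f).
apply/cvg_sup => i U [V] [[W] oW <-] Wf WU.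
by apply: filterS WU _; apply: Ff; exact: open_nbhs_nbhs.
Qed.

Lemma continuous_prodP (S : topologicalType) (I : Type)
    (T : I -> topologicalType) (f : S -> prod_topology T) :
  continuous f <-> forall i, continuous (fun x => f x i).
Proof.
split=> [cf i x|cf x]; first by have /cvg_prodP := cf x; exact.
by apply/cvg_prodP => i; exact: cf.
Qed.

Lemma eval_continuous (I : Type) (T : I -> topologicalType) (i : I) :
  continuous (fun f : prod_topology T => f i).
Proof. exact: (@proj_continuous {classic I} T i). Qed.

Lemma prod_hausdorff (I : Type) (T : I -> topologicalType) :
  (forall i, hausdorff_space (T i)) -> hausdorff_space (prod_topology T).
Proof. exact: (@hausdorff_product {classic I} T). Qed.

Lemma ptws_compact (X : topologicalType) :
  compact [set: X] -> compact [set: {ptws X -> X}].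
Proof.
move=> cX; have := @tychonoff X (fun=> X) (fun=> setT) (fun=> cX).
by congr compact; apply/seteqP; split.
Qed.

Lemma hausdorff_closed1 (T : topologicalType) (x : T) :
  hausdorff_space T -> closed [set x].
Proof. by move=> hT; apply: accessible_closed_set1; exact: hausdorff_accessible. Qed.

Lemma hausdorff_finite_closed (T : topologicalType) (A : set T) :
  hausdorff_space T -> finite_set A -> closed A.
Proof.
by move=> /hausdorff_accessible /accessible_finite_set_closed; exact.
Qed.

(** * Stone spaces and restrictions *)

Section StoneSpace.
Context {X : topologicalType} {Delta : set (set X)}.

Lemma open_stone (U : set X) :
  gen_algebra Delta U -> open [set p : stone Delta | stone_sets p U].
Proof.
move=> DU; exists [set U]; first by move=> _ ->.
by rewrite bigcup_set1.
Qed.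

Lemma stone_hausdorff : hausdorff_space (stone Delta).
Proof.
move=> p q pq; apply: stone_inj; apply/seteqP.
wlog suff : p q pq / stone_sets p `<=` stone_sets q.
  by move=> h; split; apply: h => // A B qA pB; rewrite setIC; exact: pq.
move=> U pU; have [pD _ _ _ _] := stoneP p; have DU := pD _ pU.
have [_ _ DC] := gen_algebraP Delta.
have [_ _ _ _ /(_ _ DU)[//|qCU]] := stoneP q.
have [r [/= rU rCU]] := pq _ _ (open_nbhs_nbhs (conj (open_stone DU) pU))
  (open_nbhs_nbhs (conj (open_stone (DC _ DU)) qCU)).
have [_ [_ r0] rI _ _] := stoneP r.
by case: r0; rewrite -(setICr U); exact: rI.
Qed.

Lemma gen_algebra_clopen :
  Delta `<=` @clopen X -> gen_algebra Delta `<=` @clopen X.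
Proof.
move=> Dcl; apply: smallest_sub => //; split.
- exact: clopenT.
- exact: clopenU.
- by move=> A; exact: clopenC.
Qed.

Lemma stone_point_continuous :
  Delta `<=` @clopen X -> continuous (@stone_point X Delta).
Proof.
move=> /gen_algebra_clopen Dcl; apply/continuousP => _ [D' D'D <-].
rewrite preimage_bigcup; apply: bigcup_open => U /D'D DU.
have -> : @stone_point X Delta @^-1` [set p | stone_sets p U] = U.
  by apply/seteqP; split=> x //= [].
by have [] := Dcl _ DU.
Qed.

Lemma stone_point_eqP (x y : X) :
  stone_point Delta x = stone_point Delta y <->
  forall U, Delta U -> U x <-> U y.
Proof.
split=> [e U DU|e].
  have gU : gen_algebra Delta U by exact: sub_gen_smallest.
  have {}e := congr1 (fun p => stone_sets p U) e.
  have {}e : (gen_algebra Delta U /\ U x) = (gen_algebra Delta U /\ U y) := e.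
  split=> h; first by have [] : gen_algebra Delta U /\ U y by rewrite -e.
  by have [] : gen_algebra Delta U /\ U x by rewrite e.
have genE : gen_algebra Delta `<=` [set U | U x <-> U y].
  apply: smallest_sub => //; split => //=.
  - by move=> A B; rewrite /setU/=; tauto.
  - by move=> A; rewrite /setC/=; tauto.
apply: stone_inj; apply/seteqP.
by split=> U /= [gU Uz]; split=> //; apply/(genE _ gU).
Qed.

Lemma restr_eqP (xi zeta : {ptws X -> X}) :
  restr Delta xi = restr Delta zeta <->
  forall x U, Delta U -> U (xi x) <-> U (zeta x).
Proof.
split=> [e x|e]; first by apply/stone_point_eqP; exact: (congr1 (@^~ x) e).
by apply/funext => x; apply/stone_point_eqP; exact: e.
Qed.

Lemma restr_continuous :
  Delta `<=` @clopen X -> continuous (@restr X Delta).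
Proof.
move=> Dcl; apply/continuous_prodP => x xi.
apply: (@continuous_comp _ _ _ (fun f : {ptws X -> X} => f x)).
  exact: eval_continuous.
exact: stone_point_continuous.
Qed.

Lemma restr_hausdorff : hausdorff_space {ptws X -> stone Delta}.
Proof. by apply: prod_hausdorff => _; exact: stone_hausdorff. Qed.

End StoneSpace.

(** * Counting by collisions *)

Lemma pigeonhole (T : Type) (B : set T) (l : nat) (u : 'I_l.+1 -> T) :
  (B #<= `I_l)%card -> (forall p, B (u p)) ->
  exists p q, p != q /\ u p = u q.
Proof.
move=> Bl Bu; apply: contrapT => nu.
pose v n := u (inord n).
have vinj : {in `I_l.+1 &, injective v}.
  move=> m n; rewrite !inE /= => ml nl uE.
  have [e|mn] := eqVneq (inord m : 'I_l.+1) (inord n).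
    by rewrite -(inordK ml) -(inordK nl) e.
  by case: nu; exists (inord m), (inord n).
have : (`I_l.+1 #<= `I_l)%card.
  rewrite -(card_le_eql (inj_card_eq vinj)); apply: card_le_trans Bl.
  by apply: subset_card_le => _ [n _ <-]; exact: Bu.
by rewrite card_le_II ltnn.
Qed.

(** A uniform bound on the range is expressed by collisions because these are
what survives a passage to limits, whereas a list of the values does not. *)
Lemma pigeonhole_finite (S : Type) (T : choiceType) (f : S -> T) (l : nat) :
  (forall u : 'I_l.+1 -> S, exists p q, p != q /\ f (u p) = f (u q)) ->
  finite_set (range f).
Proof.
move=> pf; apply: contrapT => /(infinite_set_fset l.+1)[B Bf lB].
have Bmem p : (p < l.+1)%N ->
    exists s, forall t0, f s = nth t0 (finmap.enum_fset B) p.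
  move=> pl; have pB : (p < size (finmap.enum_fset B))%N by exact: leq_trans lB.
  have [t0 _] : exists t0, t0 \in finmap.enum_fset B.
    by case: (finmap.enum_fset B) pB => // t ? _; exists t; rewrite mem_head.
  have [s _ fs] := Bf _ (mem_nth t0 pB).
  by exists s => t1; rewrite fs; exact: set_nth_default.
have /choice[u uE] (p : 'I_l.+1) := Bmem p (ltn_ord p).
have [p [q [pq]]] := pf u; rewrite (uE _ (f (u p))) (uE q (f (u p))).
move=> /eqP; rewrite nth_uniq ?finmap.fset_uniq//; last 2 first.
- exact: leq_trans (ltn_ord p) lB.
- exact: leq_trans (ltn_ord q) lB.
by move=> /eqP/val_inj e; rewrite e eqxx in pq.
Qed.

(** * The Ellis semigroup and its closed ideals *)

Definition closed_ideal (G : topologicalGroupType) (X : topologicalType)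
    (act : G -> X -> X) (K : set {ptws X -> X}) : Prop :=
  [/\ K !=set0, closed K, K `<=` ellis act,
      (forall xi eta, ellis act xi -> K eta -> K (xi \o eta)) &
      (forall xi eta, K xi -> ellis act eta -> K (xi \o eta))].

Section Ellis.
Context {G : topologicalGroupType} {X : topologicalType} {act : G -> X -> X}.
Hypothesis actX : flow act.

Lemma act_continuous (g : G) : continuous (act g).
Proof.
have [_ _ _ _ cact] := actX; move=> x.
apply: (@continuous_comp _ _ _ (fun x => (g, x)) (fun p => act p.1 p.2)).
  by apply: cvg_pair => //; exact: cvg_cst.
exact: cact.
Qed.

Lemma ellis_act (g : G) : ellis act (act g).
Proof. by apply: subset_closure; exists g. Qed.

Lemma ellis_closed : closed (ellis act).
Proof. exact: closed_closure. Qed.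

Lemma ellis_compact : compact (ellis act).
Proof.
have [cX _ _ _ _] := actX.
by apply: subclosed_compact ellis_closed (ptws_compact cX) _.
Qed.

(** Translations are dense in E(X), so a closed condition on a continuous image
of E(X) need only be checked on them. *)
Lemma ellis_ind (T : topologicalType) (f : {ptws X -> X} -> T) (C : set T) :
  continuous f -> closed C -> (forall g, C (f (act g))) ->
  forall xi, ellis act xi -> C (f xi).
Proof.
move=> cf clC Cg xi Exi.
have clfC : closed (f @^-1` C) by have /continuous_closedP := cf; exact.
rewrite -[C _]/((f @^-1` C) xi) ((closure_id _).1 clfC).
by apply: closureS Exi => _ [g _ <-]; exact: Cg.
Qed.

(** Composition on E(X) is continuous in its left factor for every right factor,
but in its right factor, in general, only when the left one is continuous. *)
Lemma comp_continuousl (eta : {ptws X -> X}) :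
  continuous (fun xi : {ptws X -> X} => xi \o eta : {ptws X -> X}).
Proof. by apply/continuous_prodP => x; exact: eval_continuous. Qed.

Lemma comp_continuousr (f : X -> X) : continuous f ->
  continuous (fun xi : {ptws X -> X} => f \o xi : {ptws X -> X}).
Proof.
move=> cf; apply/continuous_prodP => x xi.
apply: (@continuous_comp _ _ _ (fun h : {ptws X -> X} => h x)); last exact: cf.
exact: eval_continuous.
Qed.

Lemma ellis_comp (xi eta : {ptws X -> X}) :
  ellis act xi -> ellis act eta -> ellis act (xi \o eta).
Proof.
move=> Exi Eeta; move: xi Exi.
apply: (ellis_ind (@comp_continuousl eta) ellis_closed) => g.
apply: (ellis_ind (comp_continuousr (@act_continuous g)) ellis_closed _ Eeta).
move=> h.
suff -> : act g \o act h = act (g * h)%g by exact: ellis_act.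
by have [_ _ _ actM _] := actX; apply/funext => x; rewrite actM.
Qed.

Lemma ellis_id : ellis act id.
Proof.
have [_ _ act1 _ _] := actX.
suff <- : act 1%g = id by exact: ellis_act.
by apply/funext => x; rewrite act1.
Qed.

(** The family of all closed ideals is directed downwards: a product of a member
of [K] and a member of [L] lies in [K `&` L]. Working with all closed ideals at
once yields a directed family without an index set of finite subfamilies. *)
Lemma closed_ideal_common :
  exists2 eta, ellis act eta & forall K, closed_ideal act K -> K eta.
Proof.
have idE : closed_ideal act (ellis act).
  split=> //; [by exists id; exact: ellis_id|exact: ellis_closed|..];
    exact: ellis_comp.
have [||||eta [Eeta etaK]] :=
  @compact_directed_meet _ _ {K | closed_ideal act K} sval ellis_compact.
- by split; exists (ellis act).
- move=> [K [[xi Kxi] clK KE Kl Kr]] [L [[eta Leta] clL LE Ll Lr]].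
  suff idKL : closed_ideal act (K `&` L) by exists (exist _ _ idKL).
  split.
  + exists (xi \o eta); split; first by apply: Kr => //; exact: LE.
    by apply: Ll => //; exact: KE.
  + exact: closedI.
  + by move=> z [/KE].
  + by move=> z t Ez [Kt Lt]; split; [exact: Kl|exact: Ll].
  + by move=> z t [Kz Lz] Et; split; [exact: Kr|exact: Lr].
- by move=> [K []].
- by move=> [K [[xi Kxi] ? KE ? ?]]; exists xi; split=> //; exact: KE.
by exists eta => // K idK; exact: (etaK (exist _ K idK)).
Qed.

End Ellis.

(** * The ideal of elements with few types *)

Section FewTypes.
Context {G : topologicalGroupType} {X : topologicalType} {act : G -> X -> X}.
Hypothesis actX : flow act.
Context {D : set (set X)} (Dcl : D `<=` @clopen X).

(** At most [l] types over [D], stated as a collision among any [l.+1] of them. *)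
Definition few_types (l : nat) : set {ptws X -> X} :=
  [set eta | ellis act eta /\ forall g : 'I_l.+1 -> G, exists p q, p != q /\
    restr D (act (g p) \o eta) = restr D (act (g q) \o eta)].

Lemma few_types_finite (l : nat) (eta : {ptws X -> X}) :
  few_types l eta -> finite_set (restr D @` orbit_mul act eta).
Proof.
move=> [_ few]; rewrite /orbit_mul image_comp.
exact: pigeonhole_finite few.
Qed.

(** The part of [few_types l] that only sees group elements listed in [A] and
conditions listed in [s]; this is a closed condition on [eta], and it is the
finite amount of information that a coloring controls. *)
Definition few_types_on (l : nat) (A : seq G) (s : seq (X * set X)) :
    set {ptws X -> X} :=
  [set eta | forall g : 'I_l.+1 -> G, (forall p, g p \in A) ->
    exists p q, p != q /\ forall yU, yU \in s -> D yU.2 ->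
      yU.2 (act (g p) (eta yU.1)) <-> yU.2 (act (g q) (eta yU.1))].

Lemma few_types_on_closed (l : nat) (A : seq G) (s : seq (X * set X)) :
  closed (few_types_on l A s).
Proof.
pose agree g h (yU : X * set X) := [set eta : {ptws X -> X} |
  yU.2 (act g (eta yU.1)) <-> yU.2 (act h (eta yU.1))].
have agree_closed g h yU : D yU.2 -> closed (agree g h yU).
  move=> /Dcl[oU cU].
  pose ev k := fun eta : {ptws X -> X} => act k (eta yU.1).
  have cev k : continuous (ev k).
    move=> eta; apply: (@continuous_comp _ _ _ (fun f : {ptws X -> X} => f yU.1)).
      exact: eval_continuous.
    exact: (@act_continuous _ _ _ actX).
  have cin k : closed (ev k @^-1` yU.2).
    by have /continuous_closedP := cev k; exact.
  have cout k : closed (ev k @^-1` ~` yU.2).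
    by have /continuous_closedP := cev k; apply; exact: open_closedC.
  have -> : agree g h yU = (ev g @^-1` yU.2 `&` ev h @^-1` yU.2) `|`
      (ev g @^-1` (~` yU.2) `&` ev h @^-1` (~` yU.2)).
    apply/seteqP; split=> eta; rewrite /agree /ev /setU /setI /setC /=; last tauto.
    by move=> e; have [] := pselect (yU.2 (act g (eta yU.1))); tauto.
  by apply: closedU; exact: closedI.
have -> : few_types_on l A s =
    \bigcap_(g in [set g : 'I_l.+1 -> G | forall p, g p \in A])
    \bigcup_(pq in [set pq : 'I_l.+1 * 'I_l.+1 | pq.1 != pq.2])
    \bigcap_(yU in [set yU | yU \in s /\ D yU.2]) agree (g pq.1) (g pq.2) yU.
  apply/seteqP; split=> eta eP g gA.
    have [p [q [pq h]]] := eP g gA.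
    by exists (p, q) => // yU [yUs DU]; exact: h.
  have [[p q] pq h] := eP g gA; exists p, q; split=> // yU yUs DU; exact: h.
apply: closed_bigI => g _; apply: closed_bigcup; first exact: finite_finset.
by move=> pq _; apply: closed_bigI => yU [_]; exact: agree_closed.
Qed.

(** If [l.+1] given types are pairwise distinct, finitely many pairs of a point
and a set in [D], one for each pair of indices, witness it. *)
Lemma few_types_onE (l : nat) :
  few_types l = ellis act `&` \bigcap_(As in setT) few_types_on l As.1 As.2.
Proof.
apply/seteqP; split=> eta [Eeta few]; split=> //.
  move=> [A s] _ g _.
  have [p [q [pq /restr_eqP h]]] := few g; exists p, q; split=> // -[y U] _ DU.
  exact: h.
move=> g; apply: contrapT => nfew.
have /choice[w wP] (pq : {pq : 'I_l.+1 * 'I_l.+1 | pq.1 != pq.2}) :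
    exists yU : X * set X, D yU.2 /\
      ~ (yU.2 (act (g (val pq).1) (eta yU.1)) <->
         yU.2 (act (g (val pq).2) (eta yU.1))).
  case: pq => -[p q] /= pq; apply: contrapT => nw; apply: nfew; exists p, q.
  split=> //; apply/restr_eqP => y U DU; apply: contrapT => nU.
  by apply: nw; exists (y, U).
have [|p [q [pq h]]] := few (codom g, codom w) I g.
  by move=> p; exact: codom_f.
have [Dw] := wP (exist _ (p, q) pq); apply.
by apply: h => //; exact: codom_f.
Qed.

(** The conditions in [s] that concern [D] define a coloring, in which the color
of [h a^-1] is the list of truth values of [a h^-1 y \in U]. If [h A^-1] has few
colors, then [act h^-1] has few types among those indexed by [A]. *)
Lemma few_types_on_neq0 (l : nat) (A : seq G) (s : seq (X * set X)) :
  (1 <= l)%N ->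
  (forall (n : nat) (c : G -> {ffun 'I_n -> bool}), (1 <= n)%N ->
    ext_definable_coloring act D c ->
    forall (k : nat) (A : set G), (1 <= k)%N -> (A #= `I_k)%card ->
      exists h : G, ([set c (h * a)%g | a in A] #<= `I_l)%card) ->
  ellis act `&` few_types_on l A s !=set0.
Proof.
have [_ _ act1 actM _] := actX.
move=> l1 edr; pose s' := [seq yU <- s | `[< D yU.2 >]].
have s'P yU : yU \in s' <-> yU \in s /\ D yU.2.
  by rewrite mem_filter; split=> [/andP[/asboolP ? ->]//|[-> /asboolP ->]].
(* Colorings have at least one bit; without conditions any two types agree, and
   [1 <= l] provides two indices. *)
have [s0|s'0] := eqVneq (size s') 0.
  exists id; split; first exact: ellis_id.
  move=> g _; exists ord0, ord_max; split.
    by rewrite -val_eqE /= eq_sym -lt0n.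
  move=> yU yUs DU; have /s'P : yU \in s /\ D yU.2 by [].
  by rewrite (size0nil s0).
pose yU (i : 'I_(size s')) := tnth (in_tuple s') i.
pose c (g : G) : {ffun 'I_(size s') -> bool} :=
  [ffun i => `[< (act g @` (yU i).2) (yU i).1 >]].
(* Adjoining the unit makes [B] nonempty. *)
pose B := [set (a^-1)%g | a in [set` 1%g :: A]].
have [k Bk] : finite_set B by exact: finite_image (finite_seq _).
have k1 : (1 <= k)%N.
  case: k Bk => // /card_set_bijP[f [fB _ _]].
  suff : `I_0 (f 1%g) by [].
  by apply: fB; exists 1%g; rewrite /= ?mem_head// invg1.
have [||h hl] := edr (size s') c _ _ k B k1 Bk.
- by rewrite lt0n.
- exists (fun i => (yU i).2), (fun i => (yU i).1); split.
    by move=> i; have /s'P[] := mem_tnth i (in_tuple s').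
  by move=> g i; rewrite ffunE.
exists (act h^-1%g); split; first exact: ellis_act.
move=> g gA; have [|p [q [pq cpq]]] :=
  pigeonhole (u := fun p => c (h * (g p)^-1)%g) hl.
  by move=> p; exists (g p)^-1%g => //; exists (g p) => //=; rewrite inE gA orbT.
exists p, q; split=> // z zs Dz; have /s'P zs' : z \in s /\ D z.2 by [].
have [i zE] : exists i, z = yU i.
  by have /tnthP[i] : z \in in_tuple s' by []; exists i.
have colE a : c (h * a^-1)%g i = `[< z.2 (act a (act h^-1%g z.1)) >].
  rewrite ffunE -zE; apply: asbool_equiv_eq; split=> [[x zx <-]|zx].
    by rewrite -!actM mulgA -(mulgA a) mulVg mulg1 mulgV act1.
  by exists (act a (act h^-1%g z.1)) => //; rewrite -!actM mulgVK mulgV act1.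
have := congr1 (fun f : {ffun _ -> bool} => f i) cpq; rewrite /= !colE.
by move=> e; split=> /asboolP; [rewrite e|rewrite -e] => /asboolP.
Qed.

(** The left ideal property is first checked for translations, where it amounts to
reindexing the orbit by [g |-> g h], and then extended by closedness. *)
Lemma fin_EDRdeg_ideal : joint_fin_EDRdeg act D ->
  exists2 K, closed_ideal act K &
    forall eta, K eta -> finite_set (restr D @` orbit_mul act eta).
Proof.
move=> [l l1 edr]; exists (few_types l); last exact: few_types_finite.
have cl_few : closed (few_types l).
  rewrite few_types_onE; apply: closedI; first exact: ellis_closed.
  by apply: closed_bigI => As _; exact: few_types_on_closed.
split=> //.
- rewrite few_types_onE; apply: compact_directed_meet.
  + exact: ellis_compact.
  + by split; exact: ([::], [::]).
  + move=> [A s] [B t]; exists (A ++ B, s ++ t) => eta few.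
    split=> g gAB.
      have [|p [q [pq h]]] := few g; first by move=> p; rewrite mem_cat gAB.
      exists p, q; split=> // yU yUs; apply: h; by rewrite mem_cat yUs.
    have [|p [q [pq h]]] := few g; first by move=> p; rewrite mem_cat gAB orbT.
    exists p, q; split=> // yU yUs; apply: h; by rewrite mem_cat yUs orbT.
  + by move=> As; exact: few_types_on_closed.
  + by move=> As; exact: few_types_on_neq0.
- by move=> eta [].
- move=> xi eta Exi [Eeta few].
  apply: (ellis_ind (@comp_continuousl X eta) cl_few _ Exi) => h.
  split; first by apply: ellis_comp => //; exact: ellis_act.
  move=> g; have [p [q [pq e]]] := few (fun p => (g p * h)%g).
  have [_ _ _ actM _] := actX.
  have actE a : act a \o (act h \o eta) = act (a * h)%g \o eta.
    by apply/funext => x; rewrite /= actM.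
  by exists p, q; split=> //; rewrite !actE.
- move=> xi eta [Exi few] Eeta; split; first exact: ellis_comp.
  move=> g; have [p [q [pq /restr_eqP e]]] := few g; exists p, q; split=> //.
  by apply/restr_eqP => x U DU; exact: e.
Qed.

End FewTypes.

(** * Inverse limits of restrictions *)

Section Limits.
Context {G : topologicalGroupType} {X : topologicalType} {act : G -> X -> X}.
Hypothesis actX : flow act.
Context {I : Type} {le : I -> I -> Prop} {Delta : I -> set (set X)}.
Hypothesis Dcl : forall i, Delta i `<=` @clopen X.
Hypothesis le_dir : directed_set le.
Hypothesis le_sub : forall i j, le i j <-> Delta i `<=` Delta j.
Hypothesis Dcof : cofinal_family (range Delta).

(** A point of the inverse limit prescribes a restriction for each [i]; the
elements of [S] with the restriction prescribed at [i] form a closed nonempty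
set, which decreases as [i] grows, so some element realises all of them. *)
Lemma Phi_image (S : set {ptws X -> X}) : closed S -> S `<=` ellis act ->
  Phi Delta @` S = restr_limit act le Delta S.
Proof.
move=> clS SE; apply/seteqP; split=> [_ [xi Sxi <-]|f [fS fconn]].
  split=> [i|i j /le_sub Dij]; first by exists xi.
  by rewrite /Phi conn_restr //; exact: SE.
have [[i0] _ _ updir] := le_dir.
pose F i := S `&` [set xi | restr (Delta i) xi = f i].
have [||||xi [_ Fxi]] := @compact_directed_meet _ _ I F (ellis_compact actX).
- by split.
- move=> i j; have [k [ik jk]] := updir i j; exists k => xi [Sxi xik].
  have restrE a : le a k -> restr (Delta a) xi = f a.
    move=> ak; rewrite -(fconn _ _ ak) -xik conn_restr //; last exact: SE.
    exact/le_sub.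
  by split; split=> //; exact: restrE.
- move=> i; apply: closedI => //.
  have cr := restr_continuous (@Dcl i).
  have /continuous_closedP/(_ [set f i]) := cr; apply.
  exact: hausdorff_closed1 restr_hausdorff.
- by move=> i; have [xi Sxi xiE] := fS i; exists xi; split=> //; exact: SE.
exists xi; first by have [] := Fxi i0 Logic.I.
by apply: functional_extensionality_dep => i; have [] := Fxi i Logic.I.
Qed.

Lemma ellis_mul_closed (eta : {ptws X -> X}) : closed (ellis_mul act eta).
Proof.
have [_ hX _ _ _] := actX.
apply: compact_closed; first by apply: prod_hausdorff => _.
apply: continuous_compact (ellis_compact actX).
by apply: continuous_subspaceT; exact: comp_continuousl.
Qed.

Lemma ellis_mul_sub (eta : {ptws X -> X}) :
  ellis act eta -> ellis_mul act eta `<=` ellis act.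
Proof. by move=> Eeta _ [xi Exi <-]; exact: (ellis_comp actX). Qed.

(** [xi |-> (xi eta)|^*_D] is continuous and sends translations into a finite,
hence closed, set. *)
Lemma restr_ellis_mul (D : set (set X)) (eta : {ptws X -> X}) :
  D `<=` @clopen X -> finite_set (restr D @` orbit_mul act eta) ->
  restr D @` ellis_mul act eta = restr D @` orbit_mul act eta.
Proof.
move=> DX fin; apply/seteqP; split.
  move=> _ [_ [xi Exi <-] <-].
  apply: (@ellis_ind _ _ _ _ (fun xi : {ptws X -> X} =>
    restr D (xi \o eta : {ptws X -> X})) _ _ _ _ _ Exi).
  - move=> z; apply: (@continuous_comp _ _ _ (fun z : {ptws X -> X} =>
      z \o eta : {ptws X -> X})); first exact: comp_continuousl.
    exact: restr_continuous.
  - exact: hausdorff_finite_closed restr_hausdorff fin.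
  - by move=> g; exists (act g \o eta) => //; exists g.
apply: image_subset => _ [g _ <-]; exists (act g) => //; exact: ellis_act.
Qed.

Lemma restr_limit_orbit (eta : {ptws X -> X}) :
  (forall i, finite_set (restr (Delta i) @` orbit_mul act eta)) ->
  restr_limit act le Delta (ellis_mul act eta) =
  restr_limit act le Delta (orbit_mul act eta).
Proof.
move=> fin; rewrite /restr_limit; congr inverse_limit.
apply: functional_extensionality_dep => i.
exact: restr_ellis_mul.
Qed.

Hypothesis Xbasis : basis (@clopen X).

Lemma clopen_eq (x y : X) :
  (forall U, clopen U -> U x -> U y) -> x = y.
Proof.
move=> xy; have [_ hX _ _ _] := actX; apply: hX => A B xA yB.
have [_ /(_ x)/(_ A xA)[U [clU Ux] UA]] := Xbasis.
by exists y; split; [exact: UA (xy _ clU Ux)|exact: nbhs_singleton].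
Qed.

Lemma Phi_inj : injective (Phi Delta : {ptws X -> X} -> _).
Proof.
move=> xi zeta e; apply/funext => x; apply: clopen_eq => U.
move=> /Dcof[_ [i _ <-] DU].
have /restr_eqP/(_ x U DU)[] : restr (Delta i) xi = restr (Delta i) zeta.
  exact: (congr1 (fun f => f i) e).
by [].
Qed.

(** Continuity of the inverse is checked at each point [x]: a basic clopen
neighborhood [U] of [xi x] belongs to some [Delta i], so that membership in [U]
can be read off the [i]-th component. *)
Lemma Phi_homeomorphism :
  homeomorphism_between (ellis act) (restr_limit act le Delta (ellis act))
    (Phi Delta).
Proof.
have PhiE : Phi Delta @` ellis act = restr_limit act le Delta (ellis act).
  by apply: Phi_image => //; exact: ellis_closed.
pose inv (f : prod_topology (fun i => {ptws X -> stone (Delta i)})) :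
  {ptws X -> X} := xget (id : {ptws X -> X}) [set xi | Phi Delta xi = f].
have PhiK xi : inv (Phi Delta xi) = xi.
  by rewrite /inv; case: xgetP => [zeta _ /Phi_inj//|/(_ xi)[]].
split.
- split.
  + by move=> xi Exi; rewrite -PhiE; exists xi.
  + by move=> xi zeta _ _ /Phi_inj.
  + by rewrite -PhiE.
- apply: continuous_subspaceT; apply/continuous_prodP => i.
  exact: (restr_continuous (@Dcl i)).
exists inv; first by move=> xi _; exact: PhiK.
rewrite -PhiE; apply/subspace_continuousP => _ [xi _ <-].
rewrite /from_subspace PhiK; apply/cvg_prodP => x V Vx.
have [_ /(_ (xi x))/(_ V Vx)[U [clU Ux] UV]] := Xbasis.
have [_ [i _ <-] DU] := Dcof clU.
have gU : gen_algebra (Delta i) U by exact: sub_gen_smallest.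
pose T := prod_topology (fun i => {ptws X -> stone (Delta i)}).
have cev : continuous (fun f : T => f i x).
  move=> f; apply: (@continuous_comp _ _ _ (fun f : T => f i)
    (fun h : {ptws X -> stone (Delta i)} => h x)); exact: eval_continuous.
have : nbhs (Phi Delta xi : T) [set f : T | stone_sets (f i x) U].
  apply: open_nbhs_nbhs; split; last by split.
  by have /continuousP/(_ _ (open_stone gU)) := cev.
rewrite /= /within /=.
apply: filterS => f Uf [zeta _ zetaE].
suff : U (inv f x) by exact: UV.
by rewrite -zetaE PhiK; move: Uf; rewrite -zetaE => -[].
Qed.

End Limits.

Theorem lemma3p30 (G : topologicalGroupType) (X : topologicalType)
    (act : G -> X -> X) (x0 : X)
    (I : Type) (le : I -> I -> Prop) (Delta : I -> set (set X)) :
  zero_dimensional_ambit act x0 ->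
  (forall i, Delta i `<=` @clopen X) ->
  directed_set le ->
  (forall i j, le i j <-> Delta i `<=` Delta j) ->
  cofinal_family (range Delta) ->
  (forall i, joint_fin_EDRdeg act (Delta i)) ->
  homeomorphism_between (ellis act) (restr_limit act le Delta (ellis act))
    (Phi Delta) /\
  exists eta : {ptws X -> X},
    [/\ ellis act eta,
        (forall i, finite_set (restr (Delta i) @` orbit_mul act eta)) &
        Phi Delta @` ellis_mul act eta =
          restr_limit act le Delta (orbit_mul act eta)].
Proof.
move=> [[actX _] Xbasis] Dcl le_dir le_sub Dcof edr.
split; first exact: Phi_homeomorphism.
have [eta Eeta etaK] := closed_ideal_common actX.
have fin i : finite_set (restr (Delta i) @` orbit_mul act eta).
  by have [K /etaK Keta] := fin_EDRdeg_ideal actX (@Dcl i) (edr i); exact.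
exists eta; split=> //.
rewrite -(restr_limit_orbit Dcl fin); apply: Phi_image => //.
- exact: ellis_mul_closed.
- exact: ellis_mul_sub.
Qed.
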